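(* Let $p$ be a prime with $p\equiv 3\pmod 4$. Then $$\sum_{1\leqslant j<k\leqslant (p-1)/2}\frac{1}{\cos(2\pi j^2/p)+\cos(2\pi k^2/p)}=-\frac{p+1}{4}\cdot\frac{p-3}{4}.$$ *)

(* Defs.v *)
From mathcomp Require Export all_boot all_order all_algebra.
From mathcomp Require Export reals trigo.

(* Main.v *)
(* Write c(m) = cos (2 pi m / p).  Since -1 is not a square mod p, every class
   +-m of nonzero residues contains exactly one square, and c is even, so j ^ 2
   may be replaced by j.  The identity c(u + v) + c(u - v) = 2 c(u) c(v) and the
   bijection (u, v) |-> (u + v, u - v) then give
     sum_{a, b mod p} 1 / (c(a) + c(b)) = T ^ 2 / 2,
     sum_{b mod p} 1 / (1 + c(b)) = Q / 2,
   where T = sum_u 1 / c(u) and Q = sum_u 1 / c(u) ^ 2.  The recurrence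
   c((k + 2) u) = 2 c(u) c((k + 1) u) - c(k u), summed over u after division by
   c(u) or c(u) ^ 2, and c(p u) = 1 yield T = - p and Q = p ^ 2.  Evenness of c
   folds the full sums onto 1 <= j, k <= (p - 1) / 2, and separating the diagonal
   leaves a linear equation for the sum over j < k. *)
Require Import Defs.
From mathcomp Require Import all_boot all_order all_algebra.
From mathcomp Require Import reals trigo.
From mathcomp Require Import finfield ring lra zify.

Set Implicit Arguments.
Unset Strict Implicit.
Unset Printing Implicit Defensive.

Import Order.TTheory GRing.Theory Num.Theory.

Local Open Scope ring_scope.

(** * Recurrence, periodicity and nonvanishing of the cosines *)

Definition cosp (R : realType) (p m : nat) : R := cos (2 * pi * m%:R / p%:R).

Lemma cosp0 (R : realType) (p : nat) : cosp R p 0 = 1.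
Proof. by rewrite /cosp mulr0 mul0r cos0. Qed.

Lemma cosp_rec (R : realType) (p a b : nat) :
  cosp R p (a + b + b) + cosp R p a = 2 * cosp R p b * cosp R p (a + b).
Proof.
rewrite /cosp.
have -> : 2 * pi * (a + b + b)%:R / p%:R
    = 2 * pi * (a + b)%:R / p%:R + 2 * pi * b%:R / p%:R :> R.
  by rewrite -mulrDl -mulrDr -natrD.
have -> : 2 * pi * a%:R / p%:R
    = 2 * pi * (a + b)%:R / p%:R - 2 * pi * b%:R / p%:R :> R.
  by rewrite -mulrBl -mulrBr natrD addrK.
rewrite cosD cosB; ring.
Qed.

Lemma cosp_period (R : realType) (p k m : nat) : (0 < p)%N ->
  cosp R p (m + k * p) = cosp R p m.
Proof.
move=> p_gt0; have p0 : p%:R != 0 :> R by rewrite pnatr_eq0 -lt0n.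
rewrite /cosp.
have -> : 2 * pi * (m + k * p)%:R / p%:R
    = 2 * pi * m%:R / p%:R + (pi *+ 2) *+ k :> R.
  by rewrite natrD natrM -(mulr_natr (pi *+ 2)) -(mulr_natr pi); field.
exact: periodicn (@cosD2pi R) _ _.
Qed.

Lemma cosp_mod (R : realType) (p m : nat) : (0 < p)%N ->
  cosp R p (m %% p) = cosp R p m.
Proof.
move=> p_gt0; rewrite [in RHS](divn_eq m p) addnC.
by rewrite cosp_period.
Qed.

(** If c(u) vanished, the recurrence would make c vanish at every odd multiple of u, in particular
    at p u, where its value is 1. *)
Lemma cosp_neq0 (R : realType) (p u : nat) : odd p -> cosp R p u != 0.
Proof.
move=> p_odd; have p_gt0 : (0 < p)%N by case: p p_odd.
apply/negP => /eqP c0.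
have ev k : cosp R p (k.*2.+1 * u) = 0.
  elim: k => [|k IH]; first by rewrite mul1n.
  have := cosp_rec R p (k.*2.+1 * u) u.
  rewrite IH c0 mulr0 mul0r addr0 => <-.
  by congr cosp; rewrite doubleS !mulSn; lia.
have := ev p./2; have -> : p./2.*2.+1 = p by lia.
by rewrite mulnC -[(u * p)%N]add0n cosp_period // cosp0 => /eqP; rewrite oner_eq0.
Qed.

(* Multiplying by [2 sin (pi k / p)], which is nonzero, makes the sum telescope. *)
Lemma sum_cosp (R : realType) (p k : nat) : (0 < k < p)%N ->
  \sum_(0 <= u < p) cosp R p (k * u) = 0.
Proof.
move=> /andP[k_gt0 ltkp].
have p_gt0 : 0 < p%:R :> R by rewrite ltr0n (leq_ltn_trans _ ltkp).
have p0 : p%:R != 0 :> R by rewrite gt_eqF.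
set a : R := pi * k%:R / p%:R.
have sa : sin a != 0.
  rewrite gt_eqF // sin_gt0_pi // /a divr_gt0 ?mulr_gt0 ?pi_gt0 //= ?ltr0n //.
  by rewrite ltr_pdivrMr // ltr_pM2l ?pi_gt0 // ltr_nat.
apply: (@mulfI _ (2 * sin a)); first by rewrite mulf_neq0 ?pnatr_eq0.
rewrite mulr0 mulr_sumr.
rewrite (@telescope_sumr_eq _ _ _ (fun u => sin (2 * a * u%:R - a))) //.
  rewrite mulr0 sub0r.
  have -> : 2 * a * p%:R - a = - a + (pi *+ 2) *+ k.
    by rewrite /a -(mulr_natr (pi *+ 2)) -(mulr_natr pi); field.
  by rewrite (periodicn (@sinD2pi R)) subrr.
move=> u _; rewrite /cosp.
have -> : 2 * pi * (k * u)%:R / p%:R = 2 * a * u%:R.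
  by rewrite natrM /a; field.
have -> : 2 * a * u.+1%:R - a = 2 * a * u%:R + a.
  by rewrite -natr1; ring.
by rewrite sinD sinB; ring.
Qed.

(** * Power sums of the reciprocals 1 / c(u) *)

(** The weight [w] serves two uses: [w = 1] leads to T, and [w = 1 / c] leads to Q. *)
Lemma sum_cosp_step (R : realType) (p k : nat) (w : nat -> R) :
  odd p ->
  \sum_(0 <= u < p) cosp R p (k.+2 * u) * (w u / cosp R p u)
  = 2 * \sum_(0 <= u < p) cosp R p (k.+1 * u) * w u
    - \sum_(0 <= u < p) cosp R p (k * u) * (w u / cosp R p u).
Proof.
move=> p_odd; rewrite mulr_sumr -sumrB; apply: eq_bigr => u _.
have -> : cosp R p (k.+2 * u)
    = 2 * cosp R p u * cosp R p (k.+1 * u) - cosp R p (k * u).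
  have := cosp_rec R p (k * u) u; rewrite -mulSnr -mulSnr => <-.
  by rewrite addrK.
by have := cosp_neq0 R u p_odd => c0; field.
Qed.

Lemma sum_cosp_inv_step (R : realType) (p k : nat) : odd p -> (k.+1 < p)%N ->
  \sum_(0 <= u < p) cosp R p (k.+2 * u) / cosp R p u
  = - \sum_(0 <= u < p) cosp R p (k * u) / cosp R p u.
Proof.
move=> p_odd kp; have := @sum_cosp_step R p k (fun=> 1) p_odd.
under eq_bigr do rewrite mul1r; move=> ->.
under eq_bigr do rewrite mulr1; rewrite sum_cosp // mulr0 add0r.
by congr (- _); apply: eq_bigr => u _; rewrite mul1r.
Qed.

Lemma sum_cosp_inv_odd (R : realType) (p m : nat) : odd p -> (m.*2 < p)%N ->
  \sum_(0 <= u < p) cosp R p (m.*2.+1 * u) / cosp R p u = (-1) ^+ m * p%:R.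
Proof.
move=> p_odd; elim: m => [|m IH] mp.
  under eq_bigr => u _ do rewrite mul1n divff ?cosp_neq0 //.
  by rewrite expr0 mul1r big_const_nat subn0 iter_addr_0.
rewrite doubleS sum_cosp_inv_step ?IH ?exprS ?mulN1r ?mulNr //; lia.
Qed.

Lemma sum_cosp_inv_even (R : realType) (p m : nat) : odd p -> (m.*2 < p)%N ->
  \sum_(0 <= u < p) cosp R p (m.*2 * u) / cosp R p u
  = (-1) ^+ m * \sum_(0 <= u < p) (cosp R p u)^-1.
Proof.
move=> p_odd; elim: m => [|m IH] mp.
  by rewrite expr0 mul1r; apply: eq_bigr => u _; rewrite mul0n cosp0 mul1r.
rewrite doubleS sum_cosp_inv_step ?IH ?exprS ?mulN1r ?mulNr //; lia.
Qed.

(** Here the middle term of the recurrence does not vanish: it is twice an even-multiple sum, a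
    signed copy of T, so each step flips the sign and raises the coefficient by 2. *)
Lemma sum_cosp_sqr_inv_odd (R : realType) (p m : nat) : odd p -> (m.*2 < p)%N ->
  \sum_(0 <= u < p) cosp R p (m.*2.+1 * u) * (cosp R p u) ^- 2
  = (-1) ^+ m * m.*2.+1%:R * \sum_(0 <= u < p) (cosp R p u)^-1.
Proof.
move=> p_odd; elim: m => [|m IH] mp.
  rewrite expr0 !mul1r; apply: eq_bigr => u _.
  by have c0 := cosp_neq0 R u p_odd; rewrite mul1n; field.
have /= := @sum_cosp_step R p m.*2.+1 (fun u => (cosp R p u)^-1) p_odd.
under eq_bigr do rewrite -invfM -expr2.
rewrite -doubleS => ->; rewrite sum_cosp_inv_even //.
under eq_bigr do rewrite -invfM -expr2.
rewrite IH; last by lia.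
have -> : m.+1.*2.+1%:R = m.*2.+1%:R + 2 :> R by rewrite -natrD addn2.
by rewrite exprS; ring.
Qed.

Lemma cosp_mulp (R : realType) (p u : nat) : (0 < p)%N -> cosp R p (p * u) = 1.
Proof. by move=> p_gt0; rewrite mulnC -[(u * p)%N]add0n cosp_period ?cosp0. Qed.

Lemma sum_cosp_inv (R : realType) (p : nat) : odd p ->
  \sum_(0 <= u < p) (cosp R p u)^-1 = (-1) ^+ p./2 * p%:R.
Proof.
move=> p_odd; have pE : p./2.*2.+1 = p by lia.
rewrite -sum_cosp_inv_odd //; last by rewrite -[ltnRHS]pE.
by rewrite pE; apply: eq_bigr => u _; rewrite cosp_mulp ?mul1r // -pE.
Qed.

Lemma sum_cosp_sqr_inv (R : realType) (p : nat) : odd p ->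
  \sum_(0 <= u < p) (cosp R p u) ^- 2 = p%:R ^+ 2.
Proof.
move=> p_odd; have pE : p./2.*2.+1 = p by lia.
transitivity (\sum_(0 <= u < p) cosp R p (p./2.*2.+1 * u) * (cosp R p u) ^- 2).
  by rewrite pE; apply: eq_bigr => u _; rewrite cosp_mulp ?mul1r // -pE.
rewrite sum_cosp_sqr_inv_odd //; last by rewrite -[ltnRHS]pE.
by rewrite pE sum_cosp_inv // mulrACA -expr2 sqrr_sign mul1r.
Qed.

(** * Transfer to the field with p elements and changes of variables *)

Lemma big_Fp (R : nmodType) (p : nat) (G : nat -> R) : prime p ->
  \sum_(x : 'F_p) G x = \sum_(0 <= i < p) G i.
Proof. by move=> p_pr; rewrite -(big_mkord xpredT G) Fp_cast. Qed.

Lemma cosp_Fp_nat (R : realType) (p m : nat) : prime p ->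
  cosp R p (m%:R : 'F_p) = cosp R p m.
Proof. by move=> p_pr; rewrite val_Fp_nat // cosp_mod ?prime_gt0. Qed.

Lemma cosp_Fp_addsub (R : realType) (p : nat) (x y : 'F_p) : prime p ->
  cosp R p (x + y)%R + cosp R p (x - y)%R = 2 * cosp R p x * cosp R p y.
Proof.
move=> p_pr; have ltyp : (y < p)%N by rewrite -[ltnRHS]Fp_cast.
have -> : x + y = (x + y)%N%:R by rewrite natrD !natr_Zp.
have -> : x - y = (x + (p - y))%N%:R.
  by rewrite natrD natrB ?(ltnW ltyp) // !natr_Zp pchar_Fp_0 // sub0r.
rewrite !cosp_Fp_nat // mulrAC.
have := cosp_rec R p (x + (p - y)) y.
have -> : (x + (p - y) + y + y = (x + y) + 1 * p)%N by lia.
have -> : (x + (p - y) + y = x + 1 * p)%N by lia.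
by rewrite !cosp_period ?prime_gt0 //; lra.
Qed.

Lemma cosp_FpN (R : realType) (p : nat) (x : 'F_p) : prime p ->
  cosp R p (- x)%R = cosp R p x.
Proof.
move=> p_pr; have := cosp_Fp_addsub R 0 x p_pr.
by rewrite add0r sub0r cosp0; lra.
Qed.

(* With [p./2 = (p - 1) / 2], this map sends [x] to [x ^ 2] times the Legendre
   symbol of [x]. *)
Lemma Fp_expr_inj (p : nat) : prime p -> p = 3 %[mod 4] ->
  injective (fun x : 'F_p => x ^+ (p./2).+2).
Proof.
move=> p_pr p3 x y /= exy.
have Fexp (z : 'F_p) : z ^+ p = z by have := expf_card z; rewrite card_Fp.
(* By Fermat, the square of the map is x ^ (p + 3) = x ^ 4. *)
have e4 : x ^+ 4 = y ^+ 4.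
  have := congr1 (fun z => z ^+ 2) exy; rewrite -!exprM.
  have -> : ((p./2).+2 * 2 = p + 3)%N by lia.
  by rewrite !exprD !Fexp -!exprS.
have [x0|x0] := eqVneq x 0.
  by move: e4; rewrite x0 expr0n => /esym/eqP; rewrite expf_eq0 => /andP[_ /eqP].
have e4k k : x ^+ (4 * k) = y ^+ (4 * k) by rewrite !exprM e4.
have x4k k : x ^+ k != 0 by rewrite expf_neq0.
(* Since p is 3 mod 4, (p - 1) / 2 is odd and so is the exponent. Cancelling x ^ (4 k) leaves equal
   first or third powers; in the latter case the equal fourth powers finish. *)
have [k [pk|pk]] : exists k, (p./2).+2 = (4 * k + 1)%N \/ (p./2).+2 = (4 * k + 3)%N.
  exists ((p./2).+2 %/ 4)%N; lia.
- move: exy; rewrite pk !(exprD _ (4 * k)) -e4k !expr1; exact/mulfI/x4k.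
- have e3 : x ^+ 3 = y ^+ 3.
    by move: exy; rewrite pk !(exprD _ (4 * k)) -e4k; exact/mulfI/x4k.
  move: e4; rewrite !(exprD _ 3 1) -e3 !expr1; exact/mulfI/x4k.
Qed.

(** The factor [x ^+ p./2] is 1 or -1 for nonzero [x], and c is even. *)
Lemma cosp_Fp_expr (R : realType) (p : nat) (x : 'F_p) : prime p -> odd p ->
  cosp R p (x ^+ (p./2).+2) = cosp R p (x ^+ 2).
Proof.
move=> p_pr p_odd.
have [->|x0] := eqVneq x 0; first by rewrite !expr0n.
have: (x ^+ p./2) ^+ 2 = 1.
  apply: (mulfI x0); rewrite mulr1 -exprM -exprS.
  have -> : (p./2 * 2).+1 = p by lia.
  by have := expf_card x; rewrite card_Fp.
move=> /eqP; rewrite -(addn2 p./2) (exprD _ p./2 2) sqrf_eq1 => /orP[] /eqP ->.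
  by rewrite mul1r.
by rewrite mulN1r cosp_FpN.
Qed.

Lemma sum_cosp_square (R : realType) (V : nmodType) (p : nat) (g : R -> V) :
  prime p -> p = 3 %[mod 4] ->
  \sum_(0 <= j < p) g (cosp R p (j ^ 2)) = \sum_(0 <= j < p) g (cosp R p j).
Proof.
move=> p_pr p3; have p_odd : odd p by lia.
rewrite -!big_Fp // [RHS](reindex_inj (Fp_expr_inj p_pr p3)).
apply: eq_bigr => x _; rewrite cosp_Fp_expr //.
by rewrite -[in RHS](natr_Zp x) -natrX cosp_Fp_nat.
Qed.

Lemma Fp_two_neq0 (p : nat) : prime p -> odd p -> 2 != 0 :> 'F_p.
Proof. by move=> p_pr p_odd; rewrite -unitfE unitFpE // coprimen2.
Qed.

Lemma sum_inv_cosp_pair (R : realType) (p : nat) : prime p -> odd p ->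
  \sum_(0 <= j < p) \sum_(0 <= k < p) (cosp R p j + cosp R p k)^-1
  = (\sum_(0 <= u < p) (cosp R p u)^-1) ^+ 2 / 2.
Proof.
move=> p_pr p_odd.
under eq_bigr do rewrite -big_Fp //.
rewrite -!big_Fp // pair_big /=.
pose h (z : 'F_p * 'F_p) := (z.1 + z.2, z.1 - z.2).
have h_inj : injective h.
  move=> [a b] [c d] e.
  have e1 : a + b = c + d := congr1 fst e.
  have e2 : a - b = c - d := congr1 snd e.
  have ac : a = c.
    apply: (mulfI (Fp_two_neq0 p_pr p_odd)).
    have -> : 2 * a = (a + b) + (a - b) by ring.
    by rewrite e1 e2; ring.
  by move: e1; rewrite ac => /addrI ->.
rewrite (reindex_inj h_inj) expr2 mulr_suml mulr_suml.
under [RHS]eq_bigr do rewrite mulr_sumr mulr_suml.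
rewrite [RHS]pair_big; apply: eq_bigr => -[u v] _.
rewrite [X in X^-1 = _](cosp_Fp_addsub R u v p_pr).
have := cosp_neq0 R u p_odd; have := cosp_neq0 R v p_odd => c0 d0.
by field; rewrite c0 d0.
Qed.

(** The substitution k = 2 u is a bijection mod p and turns 1 + c(k) into 2 c(u) ^ 2. *)
Lemma sum_inv_cosp1 (R : realType) (p : nat) : prime p -> odd p ->
  \sum_(0 <= k < p) (1 + cosp R p k)^-1
  = (\sum_(0 <= u < p) (cosp R p u) ^- 2) / 2.
Proof.
move=> p_pr p_odd.
rewrite -!big_Fp // (reindex_inj (mulfI (Fp_two_neq0 p_pr p_odd))) mulr_suml.
apply: eq_bigr => u _.
have := cosp_Fp_addsub R u u p_pr; rewrite subrr cosp0.
have -> : u + u = 2 * u by ring.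
rewrite addrC => ->; have c0 := cosp_neq0 R u p_odd.
by field.
Qed.

(** * Folding full sums by symmetry *)

Lemma sum_symmetric_pairs (R : comPzRingType) (n : nat) (f : nat -> nat -> R) :
  (forall j k, f j k = f k j) ->
  \sum_(1 <= j < n.+1) \sum_(1 <= k < n.+1) f j k
  = 2 * (\sum_(1 <= j < n.+1) \sum_(j.+1 <= k < n.+1) f j k)
    + \sum_(1 <= j < n.+1) f j j.
Proof.
move=> fC; elim: n => [|n IH]; first by rewrite !big_nil mulr0 addr0.
rewrite big_nat_recr //= [X in _ + X]big_nat_recr //=.
rewrite [X in 2 * X]big_nat_recr //= (big_geq (leqnn n.+2)) addr0.
rewrite [\sum_(1 <= j < n.+2) f j j]big_nat_recr //=.
under eq_big_nat => j /andP[_ jn] do rewrite big_nat_recr //=.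
under [in RHS]eq_big_nat => j /andP[_ jn] do rewrite big_nat_recr //=.
rewrite !big_split /= IH.
under [X in _ + (X + _)]eq_bigr do rewrite fC.
by ring.
Qed.

Lemma sum_reflect (R : comPzRingType) (n : nat) (f : nat -> R) :
  (forall j, (1 <= j <= n)%N -> f (n.*2.+1 - j)%N = f j) ->
  \sum_(0 <= j < n.*2.+1) f j = f 0%N + 2 * \sum_(1 <= j < n.+1) f j.
Proof.
move=> fE; rewrite big_ltn // (big_cat_nat _ (n := n.+1)) //=; last by lia.
congr (_ + _); rewrite mulr_natl mulr2n; congr (_ + _).
rewrite -[X in \sum_(X <= _ < _) _]add1n big_addn.
have -> : (n.*2.+1 - n = n.+1)%N by lia.
rewrite big_nat_rev /=.
apply: eq_big_nat => j jn; rewrite -[RHS]fE; last by lia.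
by congr f; lia.
Qed.

Lemma cosp_square_reflect (R : realType) (p j : nat) : (j <= p)%N -> (0 < p)%N ->
  cosp R p ((p - j) ^ 2) = cosp R p (j ^ 2).
Proof.
move=> jp p_gt0; rewrite -[RHS](cosp_period R p) //.
rewrite -[LHS](cosp_period R j.*2) //; congr cosp.
(* Taking a = p - j and b = j, multiples of p are added on both sides so that the congruence becomes
   an identity free of truncated subtraction. *)
suff : forall a b, (a ^ 2 + b.*2 * (a + b) = b ^ 2 + (a + b) * (a + b))%N.
  by move=> /(_ (p - j)%N j); rewrite subnK.
by move=> a b; rewrite -!mulnn; lia.
Qed.

Theorem corollary1p4 (R : realType) (p : nat) (p_prime : prime p)
    (p_mod4 : p = 3 %[mod 4]) :
  \sum_(1 <= j < (p.-1 %/ 2).+1) \sum_(j.+1 <= k < (p.-1 %/ 2).+1)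
    (cos (2 * pi * j%:R ^+ 2 / p%:R) + cos (2 * pi * k%:R ^+ 2 / p%:R))^-1
  = - ((p%:R + 1) / 4 * ((p%:R - 3) / 4)) :> R.
Proof.
have p_odd : odd p by lia.
have p_gt0 := prime_gt0 p_prime.
set n := (p.-1 %/ 2)%N; have pE : p = n.*2.+1 by rewrite /n; lia.
have p2 : odd p./2 by lia.
pose c j := cosp R p (j ^ 2).
have c0 : c 0%N = 1 by exact: cosp0.
under eq_bigr do under eq_bigr do rewrite -!natrX.
rewrite -[LHS]/(\sum_(1 <= j < n.+1) \sum_(j.+1 <= k < n.+1) (c j + c k)^-1).
have half (g : R -> R) :
    \sum_(0 <= j < p) g (cosp R p j) = g 1 + 2 * \sum_(1 <= j < n.+1) g (c j).
  rewrite -(sum_cosp_square _ p_prime p_mod4) pE.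
  rewrite (@sum_reflect _ _ (fun j => g (cosp R n.*2.+1 (j ^ 2)))) -pE.
    by rewrite [X in g X]c0.
  by move=> j jn; rewrite cosp_square_reflect //; lia.
have T := sum_cosp_inv R p_odd; rewrite -signr_odd p2 expr1 mulN1r in T.
have Q := sum_inv_cosp1 R p_prime p_odd; rewrite sum_cosp_sqr_inv // in Q.
have P := sum_inv_cosp_pair R p_prime p_odd; rewrite T in P.
rewrite (half (fun x => x^-1)) invr1 in T.
rewrite (half (fun x => (1 + x)^-1)) in Q.
(* The outer sum is folded first; its term at 0 is the sum in [Q], folded next, and then the inner
   sums. *)
rewrite (half (fun x => \sum_(0 <= k < p) (x + cosp R p k)^-1)) in P.
rewrite (half (fun x => (1 + x)^-1)) in P.
rewrite (eq_bigr _ (fun j _ => half (fun x => (c j + x)^-1))) in P.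
rewrite big_split /= -mulr_sumr sum_symmetric_pairs in P; last first.
  by move=> j k; rewrite addrC.
have E1 : \sum_(1 <= j < n.+1) (c j + 1)^-1 = \sum_(1 <= j < n.+1) (1 + c j)^-1.
  by apply: eq_bigr => j _; rewrite addrC.
have E2 : \sum_(1 <= j < n.+1) (c j + c j)^-1 = 2^-1 * \sum_(1 <= j < n.+1) (c j)^-1.
  by rewrite mulr_sumr; apply: eq_bigr => j _; rewrite -invfM mulr_natl mulr2n.
rewrite E1 E2 in P.
have h2 : (1 + 1)^-1 = 2^-1 :> R by [].
(* Let A, B, S be the sums of 1 / c(j), 1 / (1 + c(j)) and, over j < k, 1 / (c(j) + c(k)), with c(j)
   now taken at j ^ 2. Then [T] reads 1 + 2 A = - p, [Q] reads 1/2 + 2 B = p ^ 2 / 2, and [P] reads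
   1/2 + 2 B + 2 (B + 4 S + A) = p ^ 2 / 2. Hence S = - (A + B) / 4. *)
rewrite h2 in P Q; lra.
Qed.
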